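(* Let $n\ge 2$, let $\overrightarrow{v}=(a_1,\dots,a_n)$ be an $n$-tuple of distinct elements of an ordered abelian group, and let $k$ be an integer with $1\le k\le n!-1$. Then there exists a $k\times n$ $\overrightarrow{v}$-row permuted matrix $A$ satisfying the distinct column sum property (DCS).
   Context: An ordered abelian group is an abelian group with a translation-invariant total order. Given an $n$-tuple $\overrightarrow{v}=(a_1,\dots,a_n)$ of distinct elements of an ordered abelian group, a $k\times n$ matrix $A=(\alpha_{i,j})$ is called a $\overrightarrow{v}$-row permuted matrix if the rows of $A$ are distinct permutations of the components of $\overrightarrow{v}$ (each row is a permutation of $(a_1,\dots,a_n)$ and no two rows are equal). Such a matrix satisfies the distinct column sum property (DCS) if its column sums $\sum_{i=1}^k\alpha_{i,j}$, $1\le j\le n$, are pairwise distinct. *)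

(* Defs.v *)
From mathcomp Require Import all_boot all_order all_fingroup all_algebra.

Set Implicit Arguments.
Unset Strict Implicit.
Unset Printing Implicit Defensive.

Import Order.TTheory GRing.Theory Num.Theory.
Local Open Scope ring_scope.

(* A porderZmodType carries an order and an addition with no compatibility law,
   and the order is only partial; both axioms are therefore stated here. *)
Definition ordered_abelian_group (V : porderZmodType) : Prop :=
  (forall x y : V, (x <= y) || (y <= x))
  /\ (forall x y z : V, x <= y -> x + z <= y + z).

(* [col_perm s v] is the row vector [\row_j v 0 (s j)]. *)
Definition row_permuted (V : zmodType) (n k : nat) (v : 'rV[V]_n)
    (A : 'M[V]_(k, n)) : Prop :=
  (forall i : 'I_k, exists s : 'S_n, row i A = col_perm s v)
  /\ injective (fun i : 'I_k => row i A).

Definition distinct_column_sums (V : zmodType) (n k : nat)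
    (A : 'M[V]_(k, n)) : Prop :=
  injective (fun j : 'I_n => \sum_(i < k) A i j).

(* Main.v *)
Require Import Defs.
From mathcomp Require Import all_boot all_order all_fingroup all_algebra.
From mathcomp Require Import zify.

Set Implicit Arguments.
Unset Strict Implicit.
Unset Printing Implicit Defensive.

Import Order.TTheory GRing.Theory Num.Theory.

Local Open Scope ring_scope.

(* Order the entries of the vector increasingly and complement, so that
   [2 k <= n!]: the columns of all [n!] permutations have equal sums. Call a set
   [S] of words closed if sorting two adjacent letters of a word of [S] stays in
   [S]. Words whose adjacent swap lies in [S] cancel when two neighbouring column
   sums are compared, so the column sums of [S] increase weakly, and strictly as
   soon as [S] is invariant under no adjacent swap. For [k >= 3], take the first
   [k - 1] words for an order that compares first letters and then disorder; if
   [q] is their largest first letter, add the word [q+1, 0, 1, 2, ...], which alone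
   excludes invariance under swaps of positions other than the first two. For
   [k = 2] no closed set works, and [1 0 2 3 ...], [0 2 1 3 ...] is used
   instead. *)

(** * Initial segments of finite sets and adjacent comparisons *)

(** The segment grows by a minimizer of [f] on its complement. Ties of [f] are split arbitrarily:
    only strictly smaller values are forced into [L], so every size is reached. *)
Lemma initial_segment (d : Order.disp_t) (O : orderType d) (T : finType)
    (f : T -> O) (m : nat) :
  (m <= #|T|)%N ->
  exists2 L : {set T}, #|L| = m &
    forall x y, x \in L -> (f y < f x)%O -> y \in L.
Proof.
elim: m => [_|m IH lt_mT]; first by
  exists set0; [rewrite cards0 | move=> x y; rewrite inE].
have [L cardL lowL] := IH (ltnW lt_mT).
have /card_gt0P[x0 Lx0] : (0 < #|~: L|)%N by have := cardsC L; lia.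
have [x Lx min_x] := arg_minP f Lx0.
have {}Lx : x \notin L by rewrite -in_setC; exact: Lx.
exists (x |: L) => [|y z]; first by rewrite cardsU1 cardL Lx.
rewrite !inE => /orP[/eqP-> lt_zx|Ly lt_zy]; last by rewrite (lowL y) ?orbT.
case: (boolP (z \in L)) => [|Lz]; first by rewrite orbT.
rewrite -in_setC in Lz.
by have := min_x z Lz; rewrite leNgt lt_zx.
Qed.

Lemma injective_of_adjacent_lt (d : Order.disp_t) (T : porderType d) (n : nat)
    (c : 'I_n -> T) :
  (forall i j : 'I_n, j = i.+1 :> nat -> (c i < c j)%O) -> injective c.
Proof.
move=> lt_c.
have lt_ck k : forall i j : 'I_n, j = (i + k.+1)%N :> nat -> (c i < c j)%O.
  elim: k => [|k IH] i j eq_j; first by apply: lt_c; rewrite eq_j addn1.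
  have lt_in : (i.+1 < n)%N by have := ltn_ord j; lia.
  apply: (@lt_trans _ _ (c (Ordinal lt_in))); first exact: lt_c.
  by apply: IH => /=; lia.
have lt_mono (i j : 'I_n) : (i < j)%N -> (c i < c j)%O.
  by move=> lt_ij; apply: (lt_ck (j - i.+1)%N); lia.
move=> i j eq_c; apply/val_inj; case: (ltngtP i j) => // /lt_mono.
  by rewrite eq_c ltxx.
by rewrite eq_c ltxx.
Qed.

(** * Comparing sums in an ordered abelian group *)

Section OrderedAbelianGroup.
Variables (V : porderZmodType) (hV : ordered_abelian_group V).

Lemma oag_leD (x y z t : V) : x <= y -> z <= t -> x + z <= y + t.
Proof.
move=> le_xy le_zt; apply: (le_trans (hV.2 _ _ z le_xy)).
by rewrite ![y + _]addrC hV.2.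
Qed.

Lemma oag_lteD (x y z t : V) : x < y -> z <= t -> x + z < y + t.
Proof.
move=> lt_xy le_zt; apply: (@lt_le_trans _ _ (y + z)).
  by rewrite lt_def hV.2 ?(ltW lt_xy)// (inj_eq (addIr z)) gt_eqF.
by rewrite ![y + _]addrC hV.2.
Qed.

Lemma oag_leltD (x y z t : V) : x <= y -> z < t -> x + z < y + t.
Proof. by move=> le_xy lt_zt; rewrite (addrC x) (addrC y) oag_lteD. Qed.

Lemma oag_lt_sum (I : finType) (P : pred I) (F G : I -> V) (i0 : I) :
  P i0 -> (forall i, P i -> F i < G i) ->
  \sum_(i | P i) F i < \sum_(i | P i) G i.
Proof.
move=> Pi0 lt_FG; rewrite (bigD1 i0)//= [ltRHS](bigD1 i0)//= oag_lteD ?lt_FG//.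
elim/big_ind2: _ => // [x y z t|i /andP[/lt_FG/ltW//]]; exact: oag_leD.
Qed.

(* The words [s] with [tperm i j * s] in [S] contribute equally to columns [i]
   and [j]; every other word contributes more to column [j]. *)
Lemma lt_column_sums (n : nat) (v : 'I_n -> V) (S : {set 'S_n}) (i j : 'I_n) :
  i != j ->
  (forall a b : 'I_n, (a < b)%N -> v a < v b) ->
  (forall s : 'S_n, s \in S -> (s j < s i)%N -> (tperm i j * s)%g \in S) ->
  (exists2 s : 'S_n, s \in S & (tperm i j * s)%g \notin S) ->
  \sum_(s in S) v (s i) < \sum_(s in S) v (s j).
Proof.
move=> neq_ij incr_v lowS [s0 Ss0 Sts0].
rewrite (bigID (fun s => (tperm i j * s)%g \in S))/=.
rewrite [ltRHS](bigID (fun s => (tperm i j * s)%g \in S))/=.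
apply: oag_leltD.
  rewrite (reindex_inj (mulgI (tperm i j)))/= le_eqVlt; apply/orP; left.
  apply/eqP/eq_big => [s|s _]; last by rewrite permM tpermL.
  by rewrite mulgA tperm2 mul1g andbC.
apply: (@oag_lt_sum _ _ _ _ s0) => [|s /andP[Ss Sts]]; first by rewrite Ss0.
apply: incr_v; case: (ltngtP (s i) (s j)) => //.
  by move=> /(lowS s Ss); rewrite (negbTE Sts).
by move=> /val_inj/perm_inj eq_ij; rewrite eq_ij eqxx in neq_ij.
Qed.

End OrderedAbelianGroup.

(** * Disorder of words and sets closed under sorting *)

(** The squared Euclidean distance to the identity word, a measure of disorder in the role of the
    inversion count. *)
Definition displacement (n : nat) (s : 'S_n) : int :=
  \sum_(i < n) ((i : nat)%:Z - (s i : nat)%:Z) ^+ 2.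

Lemma displacement1_lt (n : nat) (s : 'S_n) :
  s != 1%g -> displacement (1%g : 'S_n) < displacement s.
Proof.
move=> s1; have -> : displacement (1%g : 'S_n) = 0.
  by apply: big1 => i _; rewrite perm1 subrr.
have [i si] : exists i : 'I_n, s i != i.
  apply/existsP; apply: contraNT s1 => /existsPn fix_s.
  by apply/eqP/permP => i; rewrite perm1; apply/eqP; have := fix_s i; rewrite negbK.
rewrite lt_def sumr_ge0 ?andbT => [|j _]; last exact: sqr_ge0.
rewrite psumr_neq0 => [|j _]; last exact: sqr_ge0.
apply/hasP; exists i; rewrite ?mem_index_enum//=.
rewrite lt_def sqr_ge0 andbT sqrf_eq0 subr_eq0.
by apply: contra si => /eqP[/val_inj <-].
Qed.

(** The drop is exactly [2 (j - i) (s i - s j)]. *)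
Lemma displacement_tperm_lt (n : nat) (s : 'S_n) (i j : 'I_n) :
  (i < j)%N -> (s j < s i)%N -> displacement (tperm i j * s)%g < displacement s.
Proof.
move=> lt_ij lt_s; have neq_ji : j != i by apply: contraTneq lt_ij => ->; rewrite ltnn.
rewrite /displacement (bigD1 i)//= (bigD1 j)//=.
rewrite [ltRHS](bigD1 i)//= [X in _ < _ + X](bigD1 j)//=.
rewrite (eq_bigr (fun l : 'I_n => ((l : nat)%:Z - (s l : nat)%:Z) ^+ 2)); last first.
  by move=> l /andP[li lj]; rewrite permM tpermD// eq_sym.
rewrite !addrA ltrD2r !permM tpermL tpermR.
move: (nat_of_ord i) (nat_of_ord j) (nat_of_ord (s i)) (nat_of_ord (s j)) lt_ij lt_s => a b c d.
nia.
Qed.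

(* Closed under sorting two adjacent positions, but not invariant under any
   adjacent swap. *)
Definition strictly_sorting_closed (n : nat) (S : {set 'S_n}) : Prop :=
  forall i j : 'I_n, j = i.+1 :> nat ->
    (forall s : 'S_n, s \in S -> (s j < s i)%N -> (tperm i j * s)%g \in S)
    /\ exists2 s : 'S_n, s \in S & (tperm i j * s)%g \notin S.

Lemma exists_strictly_sorting_closed (m k : nat) :
  (3 <= k)%N -> (k.*2 <= (m.+3)`!)%N ->
  exists2 S : {set 'S_m.+3}, #|S| = k & strictly_sorting_closed S.
Proof.
move=> k_ge3 k_half.
pose f (s : 'S_m.+3) : nat *l int := ((s ord0 : nat), displacement s).
have [] := @initial_segment _ _ _ f k.-1; first by rewrite card_Sn; lia.
move=> L cardL lowL.
have low_fst (s t : 'S_m.+3) : s \in L -> (t ord0 < s ord0)%N -> t \in L.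
  move=> Ls lt_ts; apply: (lowL s) => //; rewrite ltEprodlexi /f /=.
  by rewrite !leEnat (ltnW lt_ts) /= leqNgt lt_ts.
have low_snd (s t : 'S_m.+3) : s \in L -> t ord0 = s ord0 -> displacement t < displacement s ->
    t \in L.
  by move=> Ls eq_ts lt_ts; apply: (lowL s) => //;
    rewrite ltEprodlexi /f /= eq_ts lexx lt_ts.
have /card_gt0P[s0 Ls0] : (0 < #|L|)%N by rewrite cardL; lia.
case: (@arg_maxnP _ s0 (mem L) (fun s : 'S_m.+3 => s ord0 : nat) Ls0) => w Lw max_w.
have {}max_w (s : 'S_m.+3) : s \in L -> (s ord0 <= w ord0)%N by exact: max_w.
have {s0 Ls0} lt_w : (w ord0 < m.+2)%N.
  rewrite ltnNge; apply/negP => w_max.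
  have w_ord : w ord0 = ord_max by apply/val_inj => /=; have := ltn_ord (w ord0); lia.
  (* If some word of [L] begins with the last letter, every word outside [L] begins with it too.
     Exchanging the letters [ord0] and [ord_max] injects those words into [L], which then holds at
     least half of all words, contrary to [k_half]. *)
  pose h (s : 'S_m.+3) := (s * tperm ord0 ord_max)%g.
  have sub : h @: (~: L) \subset L.
    apply/subsetP => _ /imsetP[s Ls ->]; rewrite inE in Ls.
    apply: (low_fst w) => //; rewrite permM.
    have -> : s ord0 = ord_max.
      apply: contraNeq Ls => s_neq; apply: (low_fst w) => //.
      rewrite w_ord ltn_neqAle -(inj_eq val_inj) /= in s_neq *.
      by rewrite s_neq -ltnS ltn_ord.
    by rewrite tpermR w_ord.
  have := subset_leq_card sub; rewrite card_imset; last exact: mulIg.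
  by have := cardsC L; rewrite card_Sn; lia.
have L1 : 1%g \in L.
  case: (posnP (w ord0)) => [w0|w_gt0].
    have [<-//|w1] := eqVneq w 1%g.
    apply: (low_snd w) => //; last exact: displacement1_lt.
    by rewrite perm1; apply/val_inj; rewrite /= w0.
  by apply: (low_fst w); rewrite ?perm1.
pose p : 'I_m.+3 := inord (w ord0).+1.
have pE : p = (w ord0).+1 :> nat by rewrite inordK.
(* The word [q+1, 0, 1, 2, ...] with q = [w ord0]; its letters after the first increase. *)
pose e : 'S_m.+3 := lift_perm ord0 p 1.
have e0 : e ord0 = p by rewrite /e lift_perm_id.
have e_lift i : e (lift ord0 i) = lift p i by rewrite /e lift_perm_lift perm1.
have Le : e \notin L by apply/negP => /max_w; rewrite e0 pE ltnn.
exists (e |: L); first by rewrite cardsU1 cardL Le; lia.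
move=> i j ij; case: (unliftP ord0 i) ij => [i' ->|->] ij.
  (* [e] is the only word of the set starting with [p], so no swap fixing the
     first letter preserves the set. *)
  have lt_ij : (lift ord0 i' < j)%N by rewrite ij.
  case: (unliftP ord0 j) ij lt_ij => [j' ->|->] // ij lt_ij.
  have lt_ij' : (i' < j')%N by move: lt_ij; rewrite !lift0.
  have fix0 (s : 'S_m.+3) : (tperm (lift ord0 i') (lift ord0 j') * s)%g ord0 = s ord0.
    by rewrite permM tpermD// eq_sym neq_lift.
  have asc_e : (e (lift ord0 i') < e (lift ord0 j'))%N.
    rewrite !e_lift /= /bump; move: (nat_of_ord i') (nat_of_ord j') lt_ij' => a b; lia.
  split=> [s|].
    rewrite !inE => /orP[/eqP->|Ls] lt_s; first by rewrite ltnNge (ltnW asc_e) in lt_s.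
    apply/orP; right; apply: (low_snd s) => //.
    exact: displacement_tperm_lt.
  exists e; first by rewrite setU11.
  rewrite !inE negb_or; apply/andP; split; last first.
    by apply/negP => /max_w; rewrite fix0 e0 pE ltnn.
  by apply: contraTneq asc_e => te; rewrite -{1}te permM tpermL ltnn.
have j1 : j = 1%N :> nat by rewrite ij.
have {ij} -> : j = lift ord0 ord0 by apply/val_inj; rewrite /= j1.
set j0 := lift ord0 ord0; set t := tperm ord0 j0.
have t_val0 (s : 'S_m.+3) : (t * s)%g ord0 = s j0 by rewrite permM tpermL.
(* For q = 0 the word [e] is [1, 0, 2, ...], so sorting its front gives the identity, which is in
   [L]. For q > 0 the sorted word begins with 0 < q. *)
have te1 : w ord0 = 0 :> nat -> (t * e)%g = 1%g.
  move=> w0; have p1 : p = 1%N :> nat by rewrite pE w0.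
  apply/permP => l; apply/val_inj; rewrite perm1; case: (unliftP ord0 l) => [l' ->|->].
    have [->|l'0] := eqVneq l' ord0; first by rewrite permM tpermR e0.
    rewrite permM tpermD ?neq_lift ?(inj_eq (@lift_inj _ _)) 1?eq_sym// e_lift /= p1 /bump.
    by move: l'0; rewrite -(inj_eq val_inj) /=; lia.
  by rewrite t_val0 e_lift /= p1.
split=> [s|].
  rewrite !inE => /orP[/eqP->|Ls] lt_s; apply/orP; right; last first.
    by apply: (low_fst s); rewrite ?t_val0.
  have [w0|w_gt0] := posnP (w ord0); first by rewrite te1.
  by apply: (low_fst w); rewrite // t_val0 e_lift /= /bump pE.
have [w0|w_gt0] := posnP (w ord0).
  (* Here all words of [L] begin with 0, and there are at least two. The swap of [s] begins with a
     nonzero letter, so it leaves [L]; it is [e] only if [s] is the identity. *)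
  have [s Ls s1] : exists2 s : 'S_m.+3, s \in L & s != 1%g.
    have : (0 < #|L :\ 1%g|)%N.
      rewrite -ltnS -[ltnRHS]add1n -[1%N in ltnRHS]/(true : nat) -L1 -cardsD1 cardL.
      by case: (k) k_ge3 => [|[|[]]].
    by case/card_gt0P => s; rewrite !inE => /andP[]; exists s.
  exists s; first by rewrite !inE Ls orbT.
  rewrite !inE negb_or; apply/andP; split.
    apply: contraNneq s1 => ts; apply/eqP.
    by move: (congr1 (fun u => t * u)%g ts); rewrite mulgA tperm2 mul1g te1.
  apply/negP => /max_w; rewrite t_val0 w0 leqn0 => /eqP sj0.
  have := max_w s Ls; rewrite w0 leqn0 => /eqP s0.
  have : s j0 = s ord0 by apply/val_inj; rewrite /= sj0 s0.
  by move=> /perm_inj.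
(* Negation modulo [m.+3] is the word [0, m+2, m+1, ..., 1]. It is in [L] as 0 < q, and its swap
   begins with the largest letter, which exceeds q. *)
pose s : 'S_m.+3 := perm (@oppr_inj 'I_m.+3).
have s0 : s ord0 = ord0 by rewrite permE; apply/val_inj; rewrite /= subn0 modnn.
have sj0 : s j0 = m.+2 :> nat by rewrite permE /= /bump /= modn_small; lia.
have Ls : s \in L by apply: (low_fst w); rewrite ?s0.
exists s; first by rewrite !inE Ls orbT.
rewrite !inE negb_or; apply/andP; split; last first.
  by apply/negP => /max_w; rewrite t_val0 sj0; lia.
apply/eqP => ts.
have p_max : p = m.+2 :> nat by rewrite -e0 -ts t_val0.
(* If the swap is [e], the letters m+1 and 1 at position 2 agree, so words have length 3. Then [L]
   has at most two words, yet contains the distinct words [1], [s] and [w]. *)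
have m0 : m = 0%N.
  pose j2 : 'I_m.+3 := lift ord0 (lift ord0 ord0).
  have : (t * s)%g j2 = e j2 by rewrite ts.
  rewrite permM tpermD// e_lift permE => /(congr1 val) /=.
  rewrite /bump p_max /= modn_small; lia.
have : (#|[set 1%g; s; w]| <= #|L|)%N.
  by apply: subset_leq_card; apply/subsetP => u; rewrite !inE => /orP[/orP[]|] /eqP->.
have s1 : s != 1%g by apply/eqP => s1; move: sj0; rewrite s1 perm1 /= /bump /=; lia.
have w1 : w != 1%g by apply/eqP => w1; move: w_gt0; rewrite w1 perm1.
have ws : w != s by apply/eqP => ws; move: w_gt0; rewrite ws s0.
rewrite setUC cardsU1 !inE (negbTE w1) (negbTE ws) cards2 eq_sym s1 cardL.
by move: k_half; rewrite m0 /factorial /=; lia.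
Qed.

(** * Sets of words with distinct column sums *)

(** The sums are v0 + v1, v0 + v2, v1 + v2, then vl + vl for l >= 3: a strictly increasing list. *)
Lemma two_words_column_sums (V : porderZmodType) (hV : ordered_abelian_group V)
    (m : nat) (v : 'I_m.+3 -> V) :
  (forall a b : 'I_m.+3, (a < b)%N -> v a < v b) ->
  exists2 S : {set 'S_m.+3}, #|S| = 2 & injective (fun j => \sum_(s in S) v (s j)).
Proof.
move=> incr_v; pose i1 : 'I_m.+3 := lift ord0 ord0.
pose i2 : 'I_m.+3 := lift ord0 (lift ord0 ord0).
have i01 : ord0 != i1 by rewrite neq_lift.
have i12 : i1 != i2 by rewrite -(inj_eq val_inj).
have i02 : ord0 != i2 by rewrite neq_lift.
exists [set tperm ord0 i1; tperm i1 i2].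
  rewrite cards2; case: eqP => // /permP/(_ ord0).
  by rewrite tpermL tpermD 1?eq_sym// => /eqP; rewrite eq_sym (negbTE i01).
have neq_ab : tperm ord0 i1 \notin [set tperm i1 i2].
  rewrite inE; apply/eqP => /permP/(_ ord0).
  by rewrite tpermL tpermD 1?eq_sym// => /eqP; rewrite eq_sym (negbTE i01).
have sumE l : \sum_(s in [set tperm ord0 i1; tperm i1 i2]) v (s l)
    = v (tperm ord0 i1 l) + v (tperm i1 i2 l) by rewrite big_setU1//= big_set1.
apply: injective_of_adjacent_lt => i j ij; rewrite !sumE.
have ordE (l1 l2 : 'I_m.+3) : l1 = l2 :> nat -> l1 = l2 by apply: val_inj.
case: i ij => [[|[|[|i]]] lt_i] /= ij.
- rewrite (ordE (Ordinal lt_i) ord0)// (ordE j i1)// !tpermL tpermR.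
  rewrite tpermD 1?eq_sym// [ltLHS]addrC; apply: (oag_leltD hV) => //; exact: incr_v.
- rewrite (ordE (Ordinal lt_i) i1)// (ordE j i2)// tpermL !tpermR.
  rewrite tpermD// [ltRHS]addrC; apply: (oag_lteD hV) => //; exact: incr_v.
- rewrite (ordE (Ordinal lt_i) i2)// tpermR !tpermD -?(inj_eq val_inj) /= ?ij//.
  by apply: (oag_lteD hV); [|apply: ltW]; apply: incr_v; rewrite ij.
- rewrite !tpermD -?(inj_eq val_inj) /= ?ij//.
  by apply: (oag_lteD hV); [|apply: ltW]; apply: incr_v; rewrite ij /=.
Qed.

Lemma exists_perm_set_column_sums (V : porderZmodType) (hV : ordered_abelian_group V)
    (n k : nat) (v : 'I_n -> V) :
  (2 <= n)%N -> (1 <= k)%N -> (k < n`!)%N ->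
  (forall a b : 'I_n, (a < b)%N -> v a < v b) ->
  exists2 S : {set 'S_n}, #|S| = k & injective (fun j => \sum_(s in S) v (s j)).
Proof.
move=> n_ge2 k_gt0 k_lt incr_v.
wlog k_half : k k_gt0 k_lt / (k.*2 <= n`!)%N => [half|].
  case: (leqP k.*2 n`!) => [|k_big]; first exact: half.
  have [||| S cardS injS] := half (n`! - k)%N; [lia..|].
  exists (~: S); first by have := cardsC S; rewrite card_Sn; lia.
  move=> i j /= eq_ij; apply: injS => /=.
  have sum_all : \sum_s v ((s : 'S_n) i) = \sum_s v ((s : 'S_n) j).
    rewrite (reindex_inj (mulgI (tperm i j)))/=.
    by apply: eq_bigr => s _; rewrite permM tpermL.
  move: sum_all; rewrite (bigID (mem S))/= [RHS](bigID (mem S))/=.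
  have compl l : \sum_(s | s \notin S) v (s l) = \sum_(s in ~: S) v (s l).
    by apply: eq_bigl => s; rewrite inE.
  by rewrite !compl eq_ij => /addIr.
have [k1|k_ne1] := eqVneq k 1%N.
  exists [set 1%g]; rewrite ?cards1//; apply: injective_of_adjacent_lt => i j ij.
  by rewrite !big_set1 !perm1 incr_v ?ij.
case: n n_ge2 v incr_v k_lt k_half => [|[|[|m]]]// _ v incr_v k_lt k_half.
  (* For two letters only [k = 1] is possible, and it is already settled. *)
  by move: k_lt; rewrite /factorial /=; lia.
have [->|k_ne2] := eqVneq k 2%N; first exact: two_words_column_sums.
have [|//|S cardS closedS] := @exists_strictly_sorting_closed m k; first lia.
exists S => //; apply: injective_of_adjacent_lt => i j ij.
have [lowS strictS] := closedS i j ij.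
apply: (lt_column_sums hV) => //.
by rewrite -(inj_eq val_inj) /= ij neq_ltn ltnSn.
Qed.

(** * Sorting the vector and assembling the matrix *)

(** Sorting the indices by their entries yields [p]; injectivity makes the weak order strict. *)
Lemma exists_increasing_col_perm (d : Order.disp_t) (T : porderType d) (n : nat)
    (v : 'rV[T]_n) :
  (forall x y : T, (x <= y)%O || (y <= x)%O) -> injective (v 0) ->
  exists p : 'S_n, forall a b : 'I_n, (a < b)%N -> (col_perm p v 0 a < col_perm p v 0 b)%O.
Proof.
move=> total_le inj_v; pose r := relpre (v 0) <=%O.
have r_total : total r by move=> i j; apply: total_le.
have r_trans : transitive r by move=> j i l; apply: le_trans.
have /tuple_permP[p sort_p] : perm_eq (sort r (enum 'I_n)) (ord_tuple n).
  by rewrite val_ord_tuple perm_sort.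
exists p => a b lt_ab; rewrite !mxE lt_def (inj_eq inj_v) (inj_eq perm_inj).
rewrite -(inj_eq val_inj) gtn_eqF//=.
have p_nth (i : 'I_n) : nth a (sort r (enum 'I_n)) i = p i.
  by rewrite sort_p -tnth_nth tnth_mktuple tnth_ord_tuple.
have := sorted_leq_nth r_trans (fun i => lexx (v 0 i)) a (sort_sorted r_total (enum 'I_n)).
move=> /(_ a b); rewrite !inE size_sort size_enum_ord !p_nth; apply => //.
exact: ltnW.
Qed.

Theorem proposition2 (V : porderZmodType) (hV : ordered_abelian_group V)
    (n k : nat) (v : 'rV[V]_n) (hn : (2 <= n)%N) (hv : injective (v 0))
    (hk : (1 <= k <= n`! - 1)%N) :
  exists A : 'M[V]_(k, n), row_permuted v A /\ distinct_column_sums A.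
Proof.
have [p incr_v] := exists_increasing_col_perm hV.1 hv.
have [|||S cardS injS] := exists_perm_set_column_sums hV _ _ _ incr_v (k := k); [lia..|].
subst k.
(* A word [s] of [S] permutes the sorted vector, so as a permutation of [v] its row is [s * p], with
   [s] applied first. *)
pose A : 'M[V]_(#|S|, n) := \matrix_(i, j) v 0 ((enum_val i * p)%g j).
have rowA i : row i A = col_perm (enum_val i * p)%g v.
  by apply/rowP => j; rewrite !mxE.
exists A; split; first split=> [i|i1 i2 /=].
- by exists (enum_val i * p)%g.
- rewrite !rowA => /rowP eq_row; apply: enum_val_inj; apply: (@mulIg _ p).
  by apply/permP => j; apply: hv; have := eq_row j; rewrite !mxE.
have sumA j : \sum_(i < #|S|) A i j = \sum_(s in S) col_perm p v 0 (s j).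
  by rewrite [RHS]big_enum_val; apply: eq_bigr => i _; rewrite !mxE permM.
by move=> j1 j2 /= eq_sum; apply: injS; rewrite /= -!sumA.
Qed.
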